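(* Let $R,Q\in\mathbb{C}[w_1,w_2]$ be nontrivial with no common factors. For each $x\in\mathbb{R}^2$ and $y\in\mathbb{R}^2_+$, let $R_{x,y}(w)=R(x_1+y_1w,x_2+y_2w)$ and $Q_{x,y}(w)=Q(x_1+y_1w,x_2+y_2w)$ be the associated one-variable polynomials, and let $C_{x,y}$ denote the ratio of their leading coefficients (that of $R_{x,y}$ over that of $Q_{x,y}$). Then $\Phi=\frac{R}{Q}$ is a two-variable rational inner Pick function if and only if, for all $x\in\mathbb{R}^2$ and $y\in\mathbb{R}^2_+$, after canceling common factors of $R_{x,y}$ and $Q_{x,y}$, these polynomials have only real zeros, say $a_1,\dots,a_m$ (zeros of $R_{x,y}$) and $b_1,\dots,b_n$ (zeros of $Q_{x,y}$), each listed in increasing order, with $n-1\le m\le n+1$, and, with $C=C_{x,y}$, one of the following holds: (i) $m=n-1$, $C<0$ and $b_1<a_1<b_2<\dots<a_{n-1}<b_n$; (ii) $m=n$ and either (a) $C<0$ and $a_1<b_1<\dots<a_n<b_n$, or (b) $C>0$ and $b_1<a_1<\dots<b_n<a_n$; (iii) $m=n+1$, $C>0$ and $a_1<b_1<a_2<\dots<b_n<a_{n+1}$.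
   Context: $\Pi$ is the open upper half-plane in $\mathbb{C}$. $\mathbb{R}^2_+$ is the set of $y=(y_1,y_2)\in\mathbb{R}^2$ with $y_1,y_2>0$. A (two-variable) rational inner Pick function on $\Pi^2$ is a rational function $\Phi:\Pi^2\to\Pi$ with no poles on $\Pi^2$ satisfying $\mathrm{Im}\,\Phi(x)=0$ for a.e. $x=(x_1,x_2)\in\mathbb{R}^2$. *)

(* Defs.v *)
From HB Require Import structures.
From mathcomp Require Import all_boot all_order all_algebra polyXY fraction complex.
From mathcomp Require Import all_classical all_reals all_analysis.

Set Implicit Arguments.
Unset Strict Implicit.
Unset Printing Implicit Defensive.

Import Order.TTheory GRing.Theory Num.Theory.
Import numFieldNormedType.Exports.

Local Open Scope ring_scope.
Local Open Scope complex_scope.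

(* C[w1, w2] is {poly {poly K[i]}}, and P.[z1, z2] (from polyXY) is the value
   of P at (z1, z2): w1 is the outer variable 'X, w2 the inner variable 'Y. *)

(* Divisibility is written out because %| on {poly A} is a pseudo-divisibility
   when A is not a field: 'Y %| 1 holds in {poly {poly K[i]}}. The units of
   {poly {poly K[i]}} are the nonzero constants. *)
Definition no_common_factor (K : realType) (R Q : {poly {poly K[i]}}) : Prop :=
  forall D A B : {poly {poly K[i]}},
    R = A * D -> Q = B * D -> D \is a GRing.unit.

Definition is_constant (K : realType) (P : {poly {poly K[i]}}) : Prop :=
  exists c : K[i], P = c%:P%:P.

(* The rational function Phi is regular at (z1, z2), with value v there; Phi
   has a pole or a point of indeterminacy at (z1, z2) if there is no such v. *)
Definition has_value (K : realType) (Phi : {fraction {poly {poly K[i]}}})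
    (z1 z2 v : K[i]) : Prop :=
  exists P S : {poly {poly K[i]}},
    [/\ Phi = tofrac P / tofrac S, S.[z1, z2] != 0
      & v = P.[z1, z2] / S.[z1, z2]].

Definition rational_inner_Pick (K : realType)
    (Phi : {fraction {poly {poly K[i]}}}) : Prop :=
  (forall z1 z2 : K[i], 0 < complex.Im z1 -> 0 < complex.Im z2 ->
     exists2 v, has_value Phi z1 z2 v & 0 < complex.Im v) /\
  {ae (@lebesgue_measure K \x @lebesgue_measure K)%E, forall x : K * K,
     exists2 v, has_value Phi x.1%:C x.2%:C v & complex.Im v = 0}.

(* P(x1 + y1 w, x2 + y2 w) as a polynomial in w *)
Definition restrict (K : realType) (x y : K * K) (P : {poly {poly K[i]}}) :
    {poly K[i]} :=
  (map_poly (fun c => c \Po ((x.2%:C)%:P + y.2%:C *: 'X)) P)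
    .[(x.1%:C)%:P + y.1%:C *: 'X].

Lemma restrictE (K : realType) (x y : K * K) (P : {poly {poly K[i]}}) w :
  (restrict x y P).[w] = P.[x.1%:C + y.1%:C * w, x.2%:C + y.2%:C * w].
Proof.
rewrite /restrict; elim/poly_ind: P => [|P c IH].
  by rewrite map_poly0 !horner0.
pose f := comp_poly (x.2%:C%:P + y.2%:C *: 'X) : {poly K[i]} -> {poly K[i]}.
rewrite -/f in IH *.
have -> : map_poly f (P * 'X + c%:P) = map_poly f P * 'X + (f c)%:P.
  by rewrite rmorphD rmorphM /= map_polyX map_polyC.
by rewrite !hornerMXaddC !(hornerD, hornerM) IH /f horner_comp !hornerE.
Qed.

(* a lists the zeros of p, all of them real, in increasing order and with
   multiplicity; %= is equality up to a nonzero constant factor, so p != 0. *)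
Definition real_zeros (K : realType) (p : {poly K[i]}) (a : seq K) : Prop :=
  p %= \prod_(t <- a) ('X - (t%:C)%:P) /\ sorted <=%R a.

(* s_1 < t_1 < s_2 < t_2 < ..., used when size s is size t or size t + 1 *)
Definition alternate (K : realType) (s t : seq K) : Prop :=
  (forall i, (i < size t)%N -> s`_i < t`_i) /\
  (forall i, (i.+1 < size s)%N -> t`_i < s`_i.+1).

(* C < 0 and 0 < C in K[i] include that C is real. *)
Definition interlacing_cases (K : realType) (C : K[i]) (a b : seq K) : Prop :=
  let m := size a in let n := size b in
  [\/ [/\ n = m.+1, C < 0 & alternate b a],
      m = n /\ (C < 0 /\ alternate a b \/ 0 < C /\ alternate b a)
    | [/\ m = n.+1, 0 < C & alternate a b]].

Definition real_interlacing_on_line (K : realType) (R Q : {poly {poly K[i]}})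
    (x y : K * K) : Prop :=
  let r := restrict x y R in
  let q := restrict x y Q in
  exists a b : seq K,
    [/\ real_zeros (r %/ gcdp r q) a, real_zeros (q %/ gcdp r q) b,
        (size b <= (size a).+1)%N /\ (size a <= (size b).+1)%N
      & interlacing_cases (lead_coef r / lead_coef q) a b].

(* Main.v *)
Require Import Defs.
From mathcomp Require Import all_boot all_order all_algebra polyXY fraction complex.
From mathcomp Require Import all_classical all_reals all_analysis.
From mathcomp Require Import measurable_realfun polyrcf ring lra.

(** Restricted to the complex line w |-> x + y w, the condition says that r/q
    maps the upper half plane to itself and the real line to itself. In one
    variable, near a zero x of multiplicity k such a quotient looks like
    g (w - x)^k, which stays in the upper half plane only if k = 1 and g > 0;
    poles are zeros of -q/r. The sign of g is determined by C and the parity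
    of the number of zeros and poles to the right of x, so zeros and poles
    alternate. Conversely, interlacing gives Im (r/q) >= 0 by induction,
    removing the largest zero or pole and inverting.

    Every point of the product of half planes lies on such a line. The strict
    inequality, and the absence of common zeros of R and Q, come from Hurwitz's
    theorem: if R and Q vanish at a point, Q has a zero nearby at which R does
    not vanish; if R = c Q at a point with c real, then R = (c - i t) Q is
    solvable nearby for small t > 0. Both contradict Im (R/Q) >= 0. *)

Import Order.TTheory GRing.Theory Num.Theory.
Import numFieldNormedType.Exports.

Set Implicit Arguments.
Unset Strict Implicit.
Unset Printing Implicit Defensive.

Local Open Scope ring_scope.
Local Open Scope complex_scope.

(** * Polynomials in two variables *)

Section FactorsOfConstants.
Variable F : closedFieldType.
Implicit Types (c d e : {poly F}) (A B C D P R Q S : {poly {poly F}}).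

(** This is [no_common_factor] over an arbitrary algebraically closed field. *)
Definition coprimeXY R Q :=
  forall D A B, R = A * D -> Q = B * D -> D \is a GRing.unit.

Lemma XsubC_dvd_map_horner B z :
  map_poly (horner_eval z) B = 0 -> exists B', B = ('X - z%:P)%:P * B'.
Proof.
move=> B0; exists (map_poly (fun c => c %/ ('X - z%:P)) B).
apply/polyP=> i; rewrite coefCM coef_map_id0 ?div0p // mulrC divpK //.
rewrite dvdp_XsubCl; apply/eqP.
by have := congr1 (fun p : {poly F} => p`_i) B0; rewrite coef_map coef0.
Qed.

(* The linear factors of [c] are distributed one by one: modulo each of them,
   [{poly {poly F}}] is the integral domain [{poly F}]. *)
Lemma polyC_dvd_mul_split c A B C :
  c != 0 -> c%:P * A = B * C ->
  exists c1 c2 B' C',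
    [/\ c = c1 * c2, B = c1%:P * B', C = c2%:P * C' & A = B' * C'].
Proof.
have [n] := ubnP (size c); elim: n c A B C => // n IH c A B C ltcn c0 E.
have [/eqP/size_poly1P[k k0 ck]|/closed_rootP[z rcz]] := eqVneq (size c) 1%N.
  exists c, 1, (k^-1%:P%:P * B), C; split; rewrite ?mulr1 ?polyC1 ?mul1r //.
    by rewrite mulrA ck -!polyCM divff // mul1r.
  by rewrite -mulrA -E ck mulrA -!polyCM mulVf // mul1r.
have /factor_theorem[c' cE] := rcz.
have X0 : 'X - z%:P != 0 :> {poly F} by rewrite polyXsubC_eq0.
have X0' : ('X - z%:P)%:P != 0 :> {poly {poly F}} by rewrite polyC_eq0.
have c'0 : c' != 0 by apply: contraNneq c0 => c'0; rewrite cE c'0 mul0r.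
have ltc' : (size c' < n)%N.
  by move: ltcn; rewrite cE size_Mmonic ?monicXsubC // size_XsubC addn2.
have : map_poly (horner_eval z) B * map_poly (horner_eval z) C = 0.
  rewrite -rmorphM -E rmorphM /= map_polyC /= /horner_eval.
  by rewrite (rootP rcz) polyC0 mul0r.
move/eqP; rewrite mulf_eq0 => /orP[] /eqP /XsubC_dvd_map_horner[B' BE].
  have E' : c'%:P * A = B' * C.
    by apply: (mulfI X0'); rewrite [RHS]mulrA -BE -E cE polyCM; ring.
  have [c1 [c2 [B1 [C1 [c'E E1 E2 E3]]]]] := IH _ _ _ _ ltc' c'0 E'.
  exists (('X - z%:P) * c1), c2, B1, C1; split=> //.
    by rewrite cE c'E mulrC mulrA.
  by rewrite BE E1 mulrA -polyCM.
have E' : c'%:P * A = B * B'.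
  by apply: (mulfI X0'); rewrite [RHS]mulrCA -BE -E cE polyCM; ring.
have [c1 [c2 [B1 [C1 [c'E E1 E2 E3]]]]] := IH _ _ _ _ ltc' c'0 E'.
exists c1, (c2 * ('X - z%:P)), B1, C1; split=> //.
  by rewrite cE c'E mulrA.
by rewrite BE E2 mulrA -polyCM [X in X%:P]mulrC.
Qed.

(** Divisibility over [{poly F}] holds only up to nonzero factors from [{poly F}]. Splitting these
    off twice turns the pseudo-gcd [D] into such a factor times [D2], a genuine common divisor and
    so a unit. Bezout then yields a nonzero [e] free of the outer variable. *)
Lemma coprimeXY_Bezout R Q : R != 0 -> coprimeXY R Q ->
  exists U V e, e != 0 /\ U * R + V * Q = e%:P.
Proof.
move=> R0 cop; set D := gcdp R Q.
have D0 : D != 0 by rewrite gcdp_eq0 (negPf R0).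
have /Pdiv.Idomain.dvdpP[[c A] /= c0] : D %| R.
  exact: Pdiv.Idomain.dvdp_gcdl.
rewrite -mul_polyC => /(polyC_dvd_mul_split c0)[c1 [c2 [A1 [D1 [cE _ DE RE]]]]].
have : D1 %| Q.
  apply: (@Pdiv.Idomain.dvdp_trans _ D); last exact: Pdiv.Idomain.dvdp_gcdr.
  by rewrite DE dvdp_mull.
move=> /Pdiv.Idomain.dvdpP[[d B] /= d0].
rewrite -mul_polyC => /(polyC_dvd_mul_split d0)[d1 [d2 [B2 [D2 [_ _ D1E QE]]]]].
have : D2 \is a GRing.unit.
  by apply: (cop D2 (A1 * d2%:P) B2) => //; rewrite RE D1E mulrA.
rewrite poly_unitE => /andP[/eqP sD2 _].
have copRQ : coprimep R Q.
  rewrite coprimep_def -/D DE D1E !mul_polyC.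
  have c20 : c2 != 0 by apply: contraNneq c0 => c20; rewrite cE c20 mulr0.
  have d20 : d2 != 0.
    apply: contraNneq D0 => d20.
    by rewrite DE D1E d20 polyC0 mul0r mulr0.
  by rewrite !size_scale ?sD2.
have /Pdiv.Idomain.Bezout_coprimepP[[U V] /= ] := copRQ.
rewrite -Pdiv.Idomain.size_poly_eq1 => /size_poly1P[e e0 E].
by exists U, V, e.
Qed.

(** Multiplying the Bezout identity by [S] shows that [Q] divides $eS$. The part of [e] that goes
    into [Q] is split once more between [R] and [W1]; what goes into [R] divides both [R] and [Q],
    so it is a unit. *)
Lemma coprimeXY_dvd R Q P S : R != 0 -> Q != 0 -> coprimeXY R Q ->
  R * S = P * Q -> exists W, S = W * Q.
Proof.
move=> R0 Q0 cop RS; have [U [V [e [e0 Be]]]] := coprimeXY_Bezout R0 cop.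
have : e%:P * S = Q * (U * P + V * S).
  by rewrite -Be mulrDl -[U * R * S]mulrA RS; ring.
move=> /(polyC_dvd_mul_split e0)[e1 [e2 [Q1 [W1 [eE QE _ SE]]]]].
have e10 : e1 != 0 by apply: contraNneq e0 => e10; rewrite eE e10 mul0r.
have Q10 : Q1 != 0 by apply: contraNneq Q0 => Q10; rewrite QE Q10 mulr0.
have : e1%:P * P = R * W1.
  by apply: (mulIf Q10); rewrite mulrAC -QE mulrC -RS SE; ring.
move=> /(polyC_dvd_mul_split e10)[f1 [f2 [R1 [W2 [fE RE WE _]]]]].
have uf1 : f1%:P \is a GRing.unit.
  by apply: (cop _ R1 (f2%:P * Q1)); rewrite 1?mulrC // QE fE polyCM; ring.
exists (W2 * f1%:P^-1).
by rewrite SE WE QE fE polyCM -(mulrA W2) -(mulrA f1%:P) mulKr //; ring.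
Qed.
End FactorsOfConstants.

Section InnerPick.
Variable K : realType.
Local Notation F := K[i].
Local Notation Re := (@complex.Re K).
Local Notation Im := (@complex.Im K).
Local Notation mu := (@lebesgue_measure K).
Local Notation prodX s := (\prod_(t <- s) ('X - (t%:C)%:P)).
Implicit Types (p q r : {poly F}) (P : {poly {poly F}}) (a b : seq K) (w : F).

(** * Null sets *)

Lemma ReD (z w : F) : Re (z + w) = Re z + Re w.
Proof. by case: z w => [a b] [c d]. Qed.
Lemma ImD (z w : F) : Im (z + w) = Im z + Im w.
Proof. by case: z w => [a b] [c d]. Qed.
Lemma ReM (z w : F) : Re (z * w) =
  Re z * Re w - Im z * Im w.
Proof. by case: z w => [a b] [c d]. Qed.
Lemma ImM (z w : F) : Im (z * w) =
  Re z * Im w + Im z * Re w.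
Proof. by case: z w => [a b] [c d]. Qed.

Lemma closed_roots p : p != 0 ->
  exists s : seq F, forall z, root p z = (z \in s).
Proof.
move=> p0; have [s ps] := closed_field_poly_normal p.
exists s => z; rewrite ps rootZ ?lead_coef_eq0 //.
by rewrite root_prod_XsubC.
Qed.

Lemma finite_real_roots (p : {poly F}) : p != 0 ->
  finite_set [set x : K | p.[x%:C] = 0]%classic.
Proof.
move=> /closed_roots[s sP].
apply: (@sub_finite_set _ _ [set` map Re s]%classic) => [x /= /rootP|].
  by rewrite sP => xs; apply/mapP; exists x%:C.
exact: finite_seq.
Qed.

Definition measurable_complex d (T : measurableType d) (f : T -> F) :=
  measurable_fun setT (fun x => Re (f x)) /\
  measurable_fun setT (fun x => Im (f x)).

Lemma measurable_complexD d (T : measurableType d) (f g : T -> F) :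
  measurable_complex f -> measurable_complex g ->
  measurable_complex (fun x => f x + g x).
Proof.
move=> [f1 f2] [g1 g2]; split.
  by under eq_fun do rewrite ReD; apply: measurable_funD.
by under eq_fun do rewrite ImD; apply: measurable_funD.
Qed.

Lemma measurable_complexM d (T : measurableType d) (f g : T -> F) :
  measurable_complex f -> measurable_complex g ->
  measurable_complex (fun x => f x * g x).
Proof.
move=> [f1 f2] [g1 g2]; split.
  under eq_fun do rewrite ReM.
  by apply: measurable_funB; apply: measurable_funM.
under eq_fun do rewrite ImM.
by apply: measurable_funD; apply: measurable_funM.
Qed.

Lemma measurable_complex_horner d (T : measurableType d) p (f : T -> F) :
  measurable_complex f -> measurable_complex (fun x => p.[f x]).
Proof.
move=> mf; elim/poly_ind: p => [|p c IH].
  by split; under eq_fun do rewrite horner0; apply: measurable_cst.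
under eq_fun do rewrite hornerMXaddC.
apply: measurable_complexD; first exact: measurable_complexM.
by split; apply: measurable_cst.
Qed.

Lemma measurable_complex_horner2 (P : {poly {poly F}}) :
  measurable_complex (fun x : K * K => P.[x.1%:C, x.2%:C]).
Proof.
have m1 : measurable_complex (fun x : K * K => x.1%:C).
  by split=> /=; [exact: measurable_fst|exact: measurable_cst].
have m2 : measurable_complex (fun x : K * K => x.2%:C).
  by split=> /=; [exact: measurable_snd|exact: measurable_cst].
elim/poly_ind: P => [|P c IH].
  by split; under eq_fun do rewrite !horner0; apply: measurable_cst.
under eq_fun do rewrite hornerMXaddC hornerD hornerM hornerC.
apply: measurable_complexD; first exact: measurable_complexM.
exact: measurable_complex_horner.
Qed.

Lemma measurable_zeros2 (P : {poly {poly F}}) :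
  measurable [set x : K * K | P.[x.1%:C, x.2%:C] = 0]%classic.
Proof.
have [m1 m2] := measurable_complex_horner2 P.
have -> : [set x : K * K | P.[x.1%:C, x.2%:C] = 0]%classic =
  (((fun x => Re P.[x.1%:C, x.2%:C]) @^-1` [set 0]) `&`
   ((fun x => Im P.[x.1%:C, x.2%:C]) @^-1` [set 0]))%classic.
  apply/seteqP; split=> x /=; first by move=> ->.
  by case: (P.[_, _]) => a b /= [-> ->].
apply: measurableI; rewrite -[X in measurable X]setTI.
  exact: m1.
exact: m2.
Qed.

(** By Fubini it suffices that almost every section is null. Off the finitely many real zeros of the
    leading coefficient in the second variable, the section is finite. *)
Lemma null_zeros2 (P : {poly {poly F}}) : P != 0 ->
  (mu \x mu)%E [set x : K * K | P.[x.1%:C, x.2%:C] = 0]%classic = 0%E.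
Proof.
move=> P0; set A := [set x | _]%classic.
have mA : measurable A := measurable_zeros2 P.
rewrite /product_measure1.
rewrite (_ : 0%E = (\int[mu]_x (cst 0%E x))%E); last by rewrite integral0.
have c0 : lead_coef (swapXY P) != 0 by rewrite lead_coef_eq0 swapXY_eq0.
apply: ge0_ae_eq_integral => //.
- exact: measurable_fun_xsection.
exists [set x | (lead_coef (swapXY P)).[x%:C] = 0]%classic; split.
- exact/countable_measurable/finite_set_countable/finite_real_roots.
- exact/countable_lebesgue_measure0/finite_set_countable/finite_real_roots.
move=> x /= /not_implyP[_]; apply: contra_notP => cx; rewrite /=.
apply/countable_lebesgue_measure0/finite_set_countable.
rewrite /xsection /A.
have : P.[x%:C%:P] != 0.
  apply: contra_not_neq cx => Px.
  rewrite horner_polyC in Px.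
  have /= := congr1 (fun p : {poly F} => p`_(size (swapXY P)).-1) Px.
  by rewrite coef_map coef0.
move=> /finite_real_roots; apply: sub_finite_set => y /=.
by rewrite inE /=.
Qed.

(** Otherwise the zero set and its complement would both be null, while the plane has infinite
    measure. *)
Lemma ae_zero_poly2 (P : {poly {poly F}}) :
  {ae (mu \x mu)%E, forall x : K * K, P.[x.1%:C, x.2%:C] = 0} -> P = 0.
Proof.
move=> aeP; apply/eqP/contraT => P0.
pose N := [set x : K * K | P.[x.1%:C, x.2%:C] = 0]%classic.
have N1 : (mu \x mu)%E.-negligible N.
  by exists N; split => //; [exact: measurable_zeros2|exact: null_zeros2].
have := negligibleU aeP N1; rewrite setUC setUCr => -[B [mB B0 TB]].
have : ((mu \x mu) setT = 0)%E.
  apply/eqP; rewrite eq_le measure_ge0 andbT.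
  by rewrite -[X in (_ <= X)%E]B0 le_measure ?inE.
rewrite -setXTT product_measure1E //.
have muT : mu [set: K] = +oo%E.
  have := lebesgue_measure_itv (`]-oo, +oo[ : interval K).
  by rewrite set_itvNyy /= => ->.
have muTT : (mu [set: K] * mu [set: K])%E = +oo%E by rewrite muT mulyy.
by move=> E; have := etrans (esym muTT) E.
Qed.

(** * Interlacing in one variable *)

(* s_0 > t_0 > s_1 > t_1 > ...: decreasing, unlike in [alternate]. *)
Definition interlaced (s t : seq K) :=
  [/\ (size t <= size s <= (size t).+1)%N,
      forall i, (i < size t)%N -> t`_i < s`_i &
      forall i, (i.+1 < size s)%N -> s`_i.+1 < t`_i].

Lemma interlaced_nil t : interlaced [::] t -> t = [::].
Proof. by case; rewrite leqn0 size_eq0 => /andP[/eqP]. Qed.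

(** Removing the largest point exchanges the two lists; this drives the inductions below. *)
Lemma interlaced_cons x s t : interlaced (x :: s) t ->
  interlaced t s /\ ((0 < size t)%N -> t`_0 < x).
Proof.
case=> /= /andP[h1 h2] h3 h4; split; last exact: h3.
split; first by rewrite -ltnS h2.
- by move=> i si; apply: h4.
- by move=> i si; apply: (h3 i.+1).
Qed.

Lemma cons_interlaced x s t : interlaced t s ->
  ((0 < size t)%N -> t`_0 < x) -> interlaced (x :: s) t.
Proof.
case=> /andP[h1 h2] h3 h4 h5; split=> /=; first by rewrite h2.
- by case=> [|i] // si; apply: h4.
- by move=> i; rewrite ltnS => si; apply: h3.
Qed.

Lemma horner_prodX s (w : F) : (prodX s).[w] = \prod_(t <- s) (w - t%:C).
Proof. by rewrite horner_prod; apply: eq_bigr => t _; rewrite hornerXsubC. Qed.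

(* The second part says that arg (S / T) <= arg (w - x); it makes the
   induction go through. *)
Lemma interlaced_Im_ge0 s t (w : F) : 0 < Im w -> interlaced s t ->
  let z := (prodX s).[w] * conjc (prodX t).[w] in
  0 <= Im z /\
  forall x, ((0 < size s)%N -> s`_0 <= x) -> Im (z * conjc (w - x%:C)) <= 0.
Proof.
move=> w0; have [n] := ubnP (size s + size t).
elim: n s t => // n IH [|x s] t ltn.
  move=> /interlaced_nil -> /=; rewrite !big_nil !hornerC.
  by clear IH; split=> [|x _]; case: w w0 => a b /= b0; simpc => /=; lra.
move=> /interlaced_cons[st tx] /=.
have [|/= h1 h2] := IH t s _ st.
  by rewrite addnC; move: ltn; rewrite /= addSn ltnS.
have {h2} := h2 x (fun h => ltW (tx h)).
rewrite big_cons hornerM hornerXsubC; move: h1.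
move: (prodX t).[w] (prodX s).[w] => z v; move: w0; clear IH.
case: z v w => [z1 z2] [v1 v2] [a b] /= b0; simpc => /= h1 h2.
split=> [|y /(_ isT) xy]; first by lra.
(* Since $\overline{w-y} = \overline{w-x} - (y-x)$, the imaginary part in the goal is minus the sum
   of this product and the next. *)
have : 0 <= (y - x) *
    ((b * (z1 * v1 + z2 * v2) - (a - x) * (z2 * v1 - z1 * v2))).
  by apply: mulr_ge0; [lra|lra].
have : 0 <= (z2 * v1 - z1 * v2) * ((a - x) ^+ 2 + b ^+ 2).
  by apply: mulr_ge0; [lra|rewrite addr_ge0 ?sqr_ge0].
by nra.
Qed.

Lemma prod_sub_sign x (s : seq K) : x \notin s ->
  0 < (-1) ^+ count (> x)%O s * \prod_(y <- s) (x - y).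
Proof.
elim: s => [_|y s IH]; first by rewrite big_nil mulr1.
rewrite inE negb_or big_cons /= => /andP[xy /IH H].
rewrite exprD mulrACA; apply: mulr_gt0 => //.
case: (ltgtP x y) xy => //= xy _;
  rewrite ?expr1 ?expr0 ?mulN1r ?mul1r ?opprB subr_gt0 //.
Qed.

(** The largest point, if any, lies in [s]: nothing exceeds it, and zero is even. Removing it lowers
    the count at every remaining point by one, so the parities swap together with the roles of the
    lists. *)
Lemma interlaced_of_parity (s t : seq K) :
  sorted >%O s -> sorted >%O t ->
  {in s, forall x, ~~ odd (count (> x)%O s + count (> x)%O t)} ->
  {in t, forall x, odd (count (> x)%O s + count (> x)%O t)} ->
  interlaced s t.
Proof.
have [n] := ubnP (size s + size t); elim: n s t => // n IH s t.
have top (y : K) u : sorted >%O (y :: u) -> all (< y)%O u.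
  by move=> /(order_path_min (rev_trans lt_trans)).
have count0 (y x : K) u : y <= x -> all (< y)%O u -> count (> x)%O u = 0%N.
  move=> yx /allP uy; apply/eqP; rewrite -leqn0 leqNgt -has_count.
  apply/hasPn => z /uy zy; rewrite -leNgt; exact: le_trans (ltW zy) yx.
case: s => [|x s] ltn ss st es ot.
  case: t ltn st ot {es} => [//|y t] ltn st /(_ y (mem_head _ _)).
  by rewrite /= ltxx (count0 y y t) // top.
have xs := top _ _ ss.
have tx : all (< x)%O t.
  case: t st es ot {ltn} => // y t st es ot.
  have yt := top _ _ st.
  suff yx : y < x.
    rewrite /= yx; apply: sub_all yt => z zy; exact: lt_trans zy yx.
  have := es x (mem_head _ _); have := ot y (mem_head _ _); rewrite /= !ltxx.
  have [//|xy|->] := ltgtP y x.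
    by rewrite (count0 x y s) ?(ltW xy) // (count0 y y t).
  by rewrite (count0 x x s) // => ->.
apply: cons_interlaced; last by case: t tx {ltn st es ot} => //= y t /andP[].
apply: IH => //.
- by rewrite addnC; move: ltn; rewrite /= addSn ltnS.
- exact: path_sorted ss.
- move=> z zt; have zx : z < x := allP tx z zt.
  by have := ot z zt; rewrite /= zx addSn /= addnC.
- move=> z zs; have := es z; rewrite inE zs orbT => /(_ isT).
  have zx : z < x := allP xs z zs.
  by rewrite /= zx addSn /= negbK addnC.
Qed.

Lemma interlaced_rev (s t : seq K) : interlaced (rev s) (rev t) <->
  size s = size t /\ alternate t s \/ size s = (size t).+1 /\ alternate s t.
Proof.
have nthr (u : seq K) i j : (i + j).+1 = size u -> (rev u)`_i = u`_j.
  move=> e; rewrite nth_rev -?e ?ltnS ?leq_addr //; congr (u`__).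
  by rewrite subSS addKn.
have ex n j : (j < n)%N -> exists i, (i + j).+1 = n.
  by move=> jn; exists (n - j.+1)%N; rewrite -addnS subnK.
split.
- case; rewrite !size_rev => /andP[h1 h2] h3 h4.
  have [e|ne] := eqVneq (size s) (size t); [left|right].
    split=> //; split=> j sj.
      have [i ie] := ex _ _ sj; rewrite -(nthr s i j) // -(nthr t i j) -?e //.
      by apply: h3; rewrite -e -ie ltnS leq_addr.
    have [i ie] := ex _ _ sj.
    rewrite -(nthr t i j.+1) // -(nthr s i.+1 j) ?e -?ie ?addnS //.
    by apply: h4; rewrite e -ie ltnS addnS ltnS leq_addr.
  have {ne} e : size s = (size t).+1.
    by apply/eqP; rewrite eqn_leq h2 ltn_neqAle eq_sym ne.
  split=> //; split=> j sj.
    have [i ie] := ex _ _ sj.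
    rewrite -(nthr t i j) // -(nthr s i.+1 j) ?e -?ie ?addSn //.
    by apply: h4; rewrite e -ie !ltnS leq_addr.
  have [i ie0] := ex _ _ sj.
  have ie : (i + j).+1 = size t by move: ie0; rewrite e addnS => -[].
  rewrite -(nthr s i j.+1) ?e -?ie ?addnS // -(nthr t i j) //.
  by apply: h3; rewrite -ie ltnS leq_addr.
case=> -[e [h1 h2]]; split; rewrite ?size_rev ?e ?leqnn ?leqnSn // => i si.
- have [j je] := ex _ _ si; rewrite addnC in je.
  rewrite (nthr s i j) ?e // (nthr t i j) //.
  by apply: h1; rewrite e -je ltnS leq_addl.
- have [j je] := ex _ _ si; rewrite addnC in je.
  rewrite (nthr s i.+1 j) ?e // (nthr t i j.+1) ?addnS -?je ?addSn //.
  by apply: h2; rewrite -je addSn !ltnS leq_addl.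
- have [j je] := ex _ _ si; rewrite addnC in je.
  rewrite (nthr s i j.+1) ?e ?addnS ?je // (nthr t i j) //.
  by apply: h2; rewrite e -je !ltnS leq_addl.
- have [j je] := ex _ _ si; rewrite addnC addSn in je.
  have jt : (i + j).+1 = size t by case: je.
  rewrite (nthr s i.+1 j) ?e ?addSn ?je // (nthr t i j) //.
  by apply: h1; rewrite -jt ltnS leq_addl.
Qed.

(** The four cases collapse to two: the sign of [c] tells whether the largest point is a zero or a
    pole, which is why the lists are read from the top. *)
Lemma interlacing_casesE (c : K) (a b : seq K) : interlacing_cases c%:C a b <->
  0 < c /\ interlaced (rev a) (rev b) \/ c < 0 /\ interlaced (rev b) (rev a).
Proof.
rewrite /interlacing_cases !interlaced_rev -(ltcR 0 c) -(ltcR c 0); split.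
  case=> [[e c0 h]|[e [[c0 h]|[c0 h]]]|[e c0 h]].
  - by right; split=> //; right.
  - by right; split=> //; left.
  - by left; split=> //; left.
  - by left; split=> //; right.
case=> -[c0 [[e h]|[e h]]].
- by apply: Or32; split=> //; right.
- by apply: Or33; split.
- by apply: Or32; split=> //; left.
- by apply: Or31; split.
Qed.

(** * Multiplicity and sign at a real zero *)

Lemma horner_Re_Im (p : {poly F}) : exists a b : {poly K},
  forall x : K, p.[x%:C] = a.[x] +i* b.[x].
Proof.
elim/poly_ind: p => [|p c [a [b IH]]].
  by exists 0, 0 => x; rewrite !horner0.
exists (a * 'X + (Re c)%:P), (b * 'X + (Im c)%:P) => x.
by rewrite !hornerMXaddC IH; case: c => c1 c2; simpc.
Qed.

Lemma horner_gt0_near0 (p : {poly K}) : 0 < p.[0] ->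
  exists2 e, 0 < e & forall x, 0 < x -> x < e -> 0 < p.[x].
Proof.
move=> /(poly_cont 0 p)[e e0 eP]; exists e => // x x0 xe.
have := eP x; rewrite subr0 gtr0_norm // => /(_ xe).
by rewrite ltr_norml => /andP[h _]; lra.
Qed.

(** On the real line $\mathrm{Im}(p\bar q)$ is a real polynomial, so a negative value at 0 persists
    nearby. *)
Lemma Im_conj_lt0_near0 (p q : {poly F}) : Im (p.[0] * conjc q.[0]) < 0 ->
  exists2 x : K, 0 < x & Im (p.[x%:C] * conjc q.[x%:C]) < 0.
Proof.
have [a [b pE]] := horner_Re_Im p; have [c [d qE]] := horner_Re_Im q.
have H x : Im (p.[x%:C] * conjc q.[x%:C]) = - (a * d - b * c).[x].
  by rewrite pE qE; simpc => /=; rewrite !hornerE; ring.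
rewrite (H 0) oppr_lt0 => /horner_gt0_near0[e e0 eP].
exists (e / 2); first by rewrite divr_gt0.
by rewrite H oppr_lt0 eP ?divr_gt0 //; lra.
Qed.

Lemma horner_prodX_real (s : seq K) (x : K) :
  (prodX s).[x%:C] = (\prod_(y <- s) (x - y))%:C.
Proof.
by rewrite horner_prodX rmorph_prod; apply: eq_bigr => y _; rewrite rmorphB.
Qed.

Lemma prodX_count (s : seq K) x :
  prodX s = ('X - (x%:C)%:P) ^+ count_mem x s * prodX [seq y <- s | y != x].
Proof.
rewrite (bigID (pred1 x)) /= big_filter; congr (_ * _).
rewrite (eq_bigr (fun=> 'X - (x%:C)%:P)); last by move=> y /eqP ->.
by rewrite big_const_seq iter_mulr_1.
Qed.

(** For $k > 1$ the chosen [k.-root] lies in the closed upper half plane, and it is not real because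
    its [k]-th power is not. *)
Lemma exists_root_upper k (e : K) : (1 < k)%N -> e != 0 ->
  exists2 u : F, 0 < Im u & u ^+ k = e *i.
Proof.
move=> k1 e0; exists (k.-root (e *i : F)); last by rewrite rootCK // ltnW.
have uk : (k.-root (e *i : F)) ^+ k = e *i by rewrite rootCK // ltnW.
have := Im_rootC_ge0 (e *i : F) k1; rewrite -complexIm (lecR 0) le_eqVlt.
move: (k.-root _) uk => [u1 u2] uk /= /orP[/eqP u20|//].
move: uk; rewrite -u20 complexr0 -rmorphXn => /= -[_ e0'].
by rewrite -e0' eqxx in e0.
Qed.

(* Near x the quotient is close to g (w - x)^k, so Im (u^k) g >= 0 for every u
   in the upper half plane. *)
Lemma simple_zero_sign (c : K) (s t : seq K) x : c != 0 ->
  (forall w, 0 < Im w ->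
    0 < Im (c%:C * (prodX s).[w] * conjc (prodX t).[w])) ->
  x \in s -> x \notin t ->
  count_mem x s = 1%N /\ 0 < c * (-1) ^+ (count (> x)%O s + count (> x)%O t).
Proof.
move=> c0 pos xs xt; set k := count_mem x s.
pose s1 := [seq y <- s | y != x].
have xs1 : x \notin s1 by rewrite mem_filter eqxx.
(* Conjugating the denominator instead of inverting it changes only a positive factor, so [g] has
   the sign of the first nonzero coefficient of the quotient at [x]. *)
pose g := c * (\prod_(y <- s1) (x - y) * \prod_(y <- t) (x - y)).
have k0 : (0 < k)%N by rewrite -has_count has_pred1.
have key (u : F) : 0 < Im u -> 0 <= Im (u ^+ k) * g.
  move=> u0; rewrite leNgt; apply/negP => neg.
  (* On the ray $x + ud$ with small real $d > 0$ the factor $d^k$ splits off, and the sign of the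
     rest is decided at $d = 0$. *)
  pose sh (p : {poly F}) := p \Po ((x%:C)%:P + u *: 'X).
  have shE p w : (sh p).[w] = p.[x%:C + u * w].
    by rewrite /sh horner_comp !hornerE.
  pose p1 := (c%:C * u ^+ k) *: sh (prodX s1).
  have [] := @Im_conj_lt0_near0 p1 (sh (prodX t)).
    rewrite hornerZ !shE mulr0 addr0 !horner_prodX_real conjc_real.
    rewrite -!mulrA -rmorphM [X in Im X](_ : _ = u ^+ k * g%:C); last first.
      by rewrite /g !rmorphM; ring.
    by move: neg; case: (u ^+ k) => u1 u2 /=; simpc => /=.
  move=> d d0; apply/negP; rewrite -leNgt ltW //.
  have := pos (x%:C + u * d%:C).
  rewrite (prodX_count s x) -/s1 -/k.
  have -> : Im (x%:C + u * d%:C) = d * Im u.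
    by case: (u) => u1 u2; simpc => /=; ring.
  rewrite mulr_gt0 // => /(_ isT).
  rewrite hornerM horner_exp hornerXsubC addrAC subrr add0r exprMn.
  rewrite hornerZ !shE -rmorphXn /=.
  set z := c%:C * u ^+ k * _ * _.
  rewrite [X in Im X](_ : _ = (d ^+ k)%:C * z); last by rewrite /z; ring.
  by case: z => z1 z2; simpc => /=; rewrite pmulr_rgt0 // exprn_gt0.
have g0 : g != 0.
  rewrite /g !mulf_neq0 // prodf_seq_neq0; apply/allP => y /= yy;
    rewrite subr_eq0.
    by apply: contraNneq xs1 => ->.
  by apply: contraNneq xt => ->.
have k1 : k = 1%N.
  apply/eqP; rewrite eqn_leq k0 andbT leqNgt; apply/negP => k1.
  (* With $u^k = -gi$ the quantity $\mathrm{Im}(u^k)\,g$ is $-g^2 < 0$. *)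
  have [|u u0 uk] := @exists_root_upper k (- g) k1; first by rewrite oppr_eq0.
  have := key u u0; rewrite uk /= mulNr oppr_ge0 leNgt => /negP; apply.
  by rewrite -expr2 exprn_even_gt0.
split=> //; have gp : 0 < g.
  rewrite lt_neqAle eq_sym g0 /=; have := key 'i%C.
  by rewrite k1 expr1 /= mul1r; apply.
have -> : count (> x)%O s = count (> x)%O s1.
  rewrite count_filter; apply: eq_count => y /=.
  by case: eqVneq => [->|]; rewrite ?ltxx ?andbT.
have := mulr_gt0 gp (mulr_gt0 (prod_sub_sign xs1) (prod_sub_sign xt)).
rewrite /g exprD; set A := _ ^+ _; set B := _ ^+ _.
set P := \prod_(_ <- _) _; set Q := \prod_(_ <- _) _.
have -> : c * (P * Q) * (A * P * (B * Q)) = (P * Q) ^+ 2 * (c * (A * B)).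
  by ring.
by rewrite pmulr_rgt0 // exprn_even_gt0 // mulf_neq0 //;
 move: g0; rewrite /g !mulf_eq0 !negb_or => /and3P[].
Qed.

(** * The equivalence for one-variable quotients *)

Lemma poly0_on_reals p : (forall x : K, p.[x%:C] = 0) -> p = 0.
Proof.
move=> p0; apply/eqP/contraT => pn0.
pose rs := [seq (n%:R : F) | n <- iota 0 (size p)].
have rs0 : all (root p) rs.
  apply/allP => _ /mapP[n _ ->]; apply/rootP.
  by have := p0 n%:R; rewrite rmorph_nat.
have rsU : uniq rs.
  by rewrite map_inj_uniq ?iota_uniq // => m n /eqP; rewrite eqr_nat => /eqP.
by have := max_poly_roots pn0 rs0 rsU; rewrite size_map size_iota ltnn.
Qed.

Lemma real_roots_factor p : (forall z, root p z -> Im z = 0) ->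
  exists2 a, sorted <=%R a & p = lead_coef p *: prodX a.
Proof.
move=> pR; have [s ps] := closed_field_poly_normal p.
have [p0|p0] := eqVneq p 0.
  by exists [::] => //; rewrite p0 lead_coef0 scale0r.
exists (sort <=%R (map Re s)); first exact: sort_le_sorted.
rewrite {1}ps; congr (_ *: _).
rewrite (perm_big _ (permEl (perm_sort _ _))) big_map.
rewrite [LHS]big_seq [RHS]big_seq; apply: eq_bigr => z zs.
have : root p z by rewrite ps rootZ ?lead_coef_eq0 // root_prod_XsubC.
by move=> /pR; case: z {zs} => x y /= ->.
Qed.

Lemma Im_realM (z : F) (c : K) : Im (c%:C * z) = c * Im z.
Proof. by case: z => x y /=; rewrite mul0r addr0. Qed.

(** At a root [z] of [r], coprimality forces the conjugated polynomial of [r] to vanish too, so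
    $\bar z$ is also a root; one of the two would lie in the upper half plane if [z] were not
    real. *)
Lemma conj_symmetric_roots r q : coprimep r q ->
  r * map_poly conjc q = map_poly conjc r * q ->
  (forall w, 0 < Im w -> r.[w] != 0) -> forall z, root r z -> Im z = 0.
Proof.
move=> cop E r0 z rz; case: (ltgtP (Im z) 0) => // zI; last first.
  by have := r0 z zI; rewrite (rootP rz) eqxx.
have : 0 < Im (conjc z) by case: z zI {rz} => x y /=; rewrite oppr_gt0.
move=> /r0; have := congr1 (horner^~ z) E; rewrite !hornerM (rootP rz) mul0r.
move/esym/eqP; rewrite mulf_eq0 (negPf (coprimep_root cop rz)) orbF.
rewrite -{1}(conjcK z) horner_map conjc_eq0 => /eqP ->; by rewrite eqxx.
Qed.

Lemma prodX_eq0 a w : Im w != 0 -> (prodX a).[w] != 0.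
Proof.
move=> w0; rewrite horner_prodX prodf_seq_neq0; apply/allP => y _ /=.
by apply: contraNneq w0 => /eqP; rewrite subr_eq0 => /eqP ->.
Qed.

Lemma Im_conjC (z w : F) : Im (z * conjc w) = - Im (w * conjc z).
Proof. by case: z w => [x y] [x' y'] /=; ring. Qed.

Lemma lead_coef_prodX a : lead_coef (prodX a) = 1.
Proof. by apply/eqP; rewrite -monicE monic_prod_XsubC. Qed.

Lemma horner_conj_real p (x : K) : (map_poly conjc p).[x%:C] = conjc p.[x%:C].
Proof. by rewrite -{1}(conjc_real x) horner_map. Qed.

(** $\mathrm{Im}(z\bar w)$ replaces $\mathrm{Im}(z/w)$: it has the same sign where $w \neq 0$, and a
    common factor [g] only multiplies it by $|g|^2$. *)
Lemma Im_mul_norm (z w g : F) :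
  Im ((z * g) * conjc (w * g)) = (Re g ^+ 2 + Im g ^+ 2) * Im (z * conjc w).
Proof. by case: z w g => [x y] [x' y'] [x'' y'']; simpc => /=; ring. Qed.

Lemma Re2_Im2_gt0 (g : F) : g != 0 -> 0 < Re g ^+ 2 + Im g ^+ 2.
Proof.
case: g => x y; rewrite eq_complex /= negb_and => /orP[x0|y0].
  by rewrite ltr_pwDl ?sqr_ge0 // exprn_even_gt0.
by rewrite ltr_wpDl ?sqr_ge0 // exprn_even_gt0.
Qed.

Lemma Re2_Im2_ge0 (g : F) : 0 <= Re g ^+ 2 + Im g ^+ 2.
Proof. by rewrite addr_ge0 ?sqr_ge0. Qed.

(** [real_interlacing_on_line] unfolds to this at the restrictions of the two polynomials. *)
Definition interlacing_pair r q := exists a b : seq K,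
    [/\ real_zeros (r %/ gcdp r q) a, real_zeros (q %/ gcdp r q) b,
        (size b <= (size a).+1)%N /\ (size a <= (size b).+1)%N
      & interlacing_cases (lead_coef r / lead_coef q) a b].

Lemma interlacing_of_Pick r q :
  (forall w, 0 < Im w -> 0 < Im (r.[w] * conjc q.[w])) ->
  (forall x : K, Im (r.[x%:C] * conjc q.[x%:C]) = 0) ->
  interlacing_pair r q.
Proof.
move=> pos real.
have q0 : q != 0.
  apply/eqP => q0; have := pos 'i%C ltr01.
  by rewrite q0 horner0 conjc0 mulr0 ltxx.
have g0 : gcdp r q != 0 by rewrite gcdp_eq0 (negPf q0) andbF.
set g := gcdp r q in g0 *; set r1 := r %/ g; set q1 := q %/ g.
have rE : r = r1 * g by rewrite divpK // dvdp_gcdl.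
have qE : q = q1 * g by rewrite divpK // dvdp_gcdr.
have cop : coprimep r1 q1 by apply: coprimep_div_gcd; rewrite q0 orbT.
(* The quotient is real on the real line, so this identity holds for [r] and [q] at all real points,
   hence identically; the common factor is then cancelled. *)
have symm : r1 * map_poly conjc q1 = map_poly conjc r1 * q1.
  have gg : g * map_poly conjc g != 0 by rewrite mulf_neq0 ?map_poly_eq0.
  apply: (mulIf gg).
  suff : r * map_poly conjc q - map_poly conjc r * q = 0.
    rewrite rE qE !rmorphM /= => /eqP.
    by rewrite subr_eq0 mulrACA => /eqP ->; ring.
  apply: poly0_on_reals => x; rewrite hornerD hornerN !hornerM.
  rewrite !horner_conj_real.
  have := real x; case: r.[_] q.[_] => [x1 y1] [x2 y2] /=; simpc => /= h.
  by apply/eqP; rewrite eq_complex /=; apply/andP; split; apply/eqP; lra.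
have pos1 w : 0 < Im w -> 0 < Im (r1.[w] * conjc q1.[w]).
  move=> w0; have := pos w w0; rewrite rE qE !hornerM Im_mul_norm => h.
  rewrite ltNge; apply: contraTN h => h.
  by rewrite -leNgt mulr_ge0_le0 ?Re2_Im2_ge0.
have r1n0 w : 0 < Im w -> r1.[w] != 0.
  by move=> /pos1; apply: contraTneq => ->; rewrite mul0r ltxx.
have q1n0 w : 0 < Im w -> q1.[w] != 0.
  by move=> /pos1; apply: contraTneq => ->; rewrite conjc0 mulr0 ltxx.
have [a sa r1E] := real_roots_factor (conj_symmetric_roots cop symm r1n0).
have cop' : coprimep q1 r1 by rewrite coprimep_sym.
have symm' : q1 * map_poly conjc r1 = map_poly conjc q1 * r1.
  by rewrite mulrC -symm mulrC.
have [b sb q1E] := real_roots_factor (conj_symmetric_roots cop' symm' q1n0).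
set cr := lead_coef r1 in r1E; set cq := lead_coef q1 in q1E.
have cr0 : cr != 0.
  rewrite lead_coef_eq0; have := r1n0 'i%C ltr01.
  by apply: contraNneq => ->; rewrite horner0.
have cq0 : cq != 0.
  rewrite lead_coef_eq0; have := q1n0 'i%C ltr01.
  by apply: contraNneq => ->; rewrite horner0.
(* Comparing leading coefficients in [symm] shows that the ratio equals its conjugate. *)
have [c CE] : exists c : K, cr / cq = c%:C.
  exists (Re (cr / cq)).
  have : conjc (cr / cq) = cr / cq.
    rewrite rmorphM /= conjc_inv; apply/eqP; rewrite eqr_div ?conjc_eq0 //.
    by have := congr1 lead_coef symm; rewrite !lead_coefM !lead_coef_map => ->.
  by case: (cr / cq) => x y /= [] h; rewrite -complexr0; congr Complex; lra.
have crE : cr = c%:C * cq by rewrite -CE divfK.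
have c0 : c != 0 by apply: contraNneq cr0 => c0; rewrite crE c0 mul0r.
have leadE : lead_coef r / lead_coef q = c%:C.
  rewrite rE qE !lead_coefM -/cr -/cq.
  by rewrite -mulf_div divff ?lead_coef_eq0 // mulr1.
have posc w : 0 < Im w -> 0 < Im (c%:C * (prodX a).[w] * conjc (prodX b).[w]).
  move=> w0; have := pos1 w w0.
  rewrite r1E q1E !hornerZ crE [c%:C * cq * _]mulrAC [cq * _]mulrC Im_mul_norm.
  by rewrite pmulr_rgt0 // Re2_Im2_gt0.
have rootE p d s : d != 0 -> p = d *: prodX s ->
    forall x : K, (x \in s) = root p x%:C.
  move=> d0 -> x; rewrite rootZ //.
  rewrite -(big_map (fun t => t%:C) predT (fun t => 'X - t%:P)).
  by rewrite root_prod_XsubC mem_map //; exact: complexI.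
have xab x : x \in a -> x \notin b.
  rewrite (rootE _ _ _ cr0 r1E) (rootE _ _ _ cq0 q1E) => rx.
  exact: (coprimep_root cop rx).
have xba x : x \in b -> x \notin a by apply: contraTN; exact: xab.
have ha x : x \in a -> _ := fun xa => simple_zero_sign c0 posc xa (xab _ xa).
have Nc0 : - c != 0 by rewrite oppr_eq0.
(* The same local analysis with the lists exchanged and [- c] for [c]. *)
have hb x : x \in b -> count_mem x b = 1%N /\
    0 < - c * (-1) ^+ (count (> x)%O b + count (> x)%O a).
  move=> xb; apply: simple_zero_sign (xba _ xb) => // w /posc.
  by rewrite -!mulrA !Im_realM Im_conjC mulrN mulNr.
have rsort (s : seq K) : sorted <=%R s ->
    (forall x, x \in s -> count_mem x s = 1%N) -> sorted >%O (rev s).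
  move=> ss sc; rewrite rev_sorted -[sorted _ _]/(sorted <%O s).
  rewrite lt_sorted_uniq_le ss andbT.
  apply: count_mem_uniq => x; case: (boolP (x \in s)) => [/sc ->//|].
  by rewrite -has_pred1 has_count -leqNgt leqn0 => /eqP.
have sra := rsort _ sa (fun x xa => (ha x xa).1).
have srb := rsort _ sb (fun x xb => (hb x xb).1).
have even n (e : K) : 0 < e -> 0 < e * (-1) ^+ n -> ~~ odd n.
  move=> e0; rewrite pmulr_rgt0 // -signr_odd.
  by case: odd => //; rewrite expr1 oppr_gt0 ltr10.
have odd' n (e : K) : 0 < - e -> 0 < e * (-1) ^+ n -> odd n.
  move=> e0; rewrite -[e]opprK mulNr -mulrN pmulr_rgt0 // -signr_odd.
  by case: odd => //; rewrite expr0 oppr_gt0 ltr10.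
have cases : interlacing_cases c%:C a b.
  apply/interlacing_casesE; have [c_gt0|c_lt0] : 0 < c \/ c < 0.
  - by move: c0; rewrite neq_lt => /orP[]; [right|left].
  - left; split=> //.
    apply: interlaced_of_parity => // x; rewrite mem_rev !count_rev.
      by move=> /ha[_]; apply: even.
    by move=> /hb[_]; rewrite addnC; apply: odd'; rewrite opprK.
  - right; split=> //.
    apply: interlaced_of_parity => // x; rewrite mem_rev !count_rev.
      by move=> /hb[_]; apply: even; rewrite oppr_gt0.
    by move=> /ha[_]; rewrite addnC; apply: odd'; rewrite oppr_gt0.
exists a, b; split.
- by split=> //; rewrite -/r1 {1}r1E eqp_scale.
- by split=> //; rewrite -/q1 {1}q1E eqp_scale.
- case: cases => [[->]|[->]|[->]]; rewrite ?leqnn ?leqnSn; split=> //;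
    by rewrite -ltnS ltnW.
- by rewrite leadE.
Qed.

(** Leading coefficients are moved into [g], leaving monic real products and a single real ratio
    [c]. *)
Lemma interlacing_pair_factor r q : interlacing_pair r q ->
  exists (a b : seq K) (c : K) (g : {poly F}),
  [/\ r = c%:C *: (prodX a * g), q = prodX b * g &
    0 < c /\ interlaced (rev a) (rev b) \/ c < 0 /\ interlaced (rev b) (rev a)].
Proof.
case=> a [b [[ra _] [rb _] _]].
set g := gcdp r q in ra rb *.
have rE : r = r %/ g * g by rewrite divpK // dvdp_gcdl.
have qE : q = q %/ g * g by rewrite divpK // dvdp_gcdr.
have scaleE p s : p %= prodX s -> exists2 k, k != 0 & p = k *: prodX s.
  move=> /eqpP[[k1 k2] /= /andP[k10 k20] e]; exists (k1^-1 * k2).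
    by rewrite mulf_neq0 // invr_neq0.
  by rewrite -scalerA -e scalerA mulVf // scale1r.
have [cr cr0 r1E] := scaleE _ _ ra; have [cq cq0 q1E] := scaleE _ _ rb.
have {}rE : r = cr *: (prodX a * g) by rewrite {1}rE r1E scalerAl.
have {}qE : q = prodX b * (cq *: g) by rewrite {1}qE q1E -scalerAl scalerAr.
(* A zero gcd would make [q], and with it the quotient [q %/ g], zero, contrary to [rb]. *)
have g0 : g != 0.
  apply: contraTneq rb => g0; rewrite qE g0 scaler0 mulr0 div0p.
  by rewrite eqp_sym eqp0 -lead_coef_eq0 lead_coef_prodX oner_eq0.
move=> cs.
have CE : lead_coef r / lead_coef q = cr / cq.
  rewrite rE qE lead_coefZ !lead_coefM lead_coefZ !lead_coef_prodX !mul1r.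
  by rewrite -mulf_div divff ?lead_coef_eq0 // mulr1.
have [c cE] : exists c : K, cr / cq = c%:C.
  exists (Re (cr / cq)); rewrite -CE.
  (* In [K[i]] a number comparable with 0 is real. *)
  have real (C : F) : C < 0 \/ 0 < C -> C = (Re C)%:C.
    case: C => x y /= []; rewrite ltcE /= => /andP[/eqP e _];
      by rewrite -complexr0; congr Complex; lra.
  by apply: real; case: cs => [[_]|[_ [[]|[]]]|[_]]; auto.
exists a, b, c, (cq *: g); split=> //.
  by rewrite rE -scalerAr scalerA -cE divfK.
by apply/interlacing_casesE; rewrite -cE -CE.
Qed.

(** The assumption at [w] keeps the cancelled factor [g], whose zeros are unrestricted, from
    vanishing there; the two products have only real zeros. *)
Lemma interlacing_pair_Im_ge0 r q w : interlacing_pair r q -> 0 < Im w ->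
  r.[w] != 0 \/ q.[w] != 0 -> q.[w] != 0 /\ 0 <= Im (r.[w] * conjc q.[w]).
Proof.
move=> /interlacing_pair_factor[a [b [c [g [-> -> cs]]]]] w0.
rewrite hornerZ !hornerM => gw0.
have gw : g.[w] != 0.
  by case: gw0; apply: contraNneq => ->; rewrite !mulr0.
have bw : (prodX b).[w] != 0 by rewrite prodX_eq0 // gt_eqF.
split; first by rewrite mulf_neq0.
rewrite mulrA Im_mul_norm mulr_ge0 ?Re2_Im2_ge0 // -mulrA Im_realM.
case: cs => -[c0].
  move=> /(interlaced_Im_ge0 w0)[].
  rewrite !(perm_big _ (permEl (perm_rev _))) /=.
  by move=> h _; rewrite mulr_ge0 // ltW.
move=> /(interlaced_Im_ge0 w0)[].
rewrite !(perm_big _ (permEl (perm_rev _))) /=.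
by move=> h _; rewrite Im_conjC mulrN -mulNr mulr_ge0 // oppr_ge0 ltW.
Qed.

Lemma interlacing_pair_real r q (x : K) : interlacing_pair r q ->
  Im (r.[x%:C] * conjc q.[x%:C]) = 0.
Proof.
move=> /interlacing_pair_factor[a [b [c [g [-> -> _]]]]].
rewrite hornerZ !hornerM mulrA Im_mul_norm -mulrA Im_realM !horner_prodX_real.
by rewrite conjc_real -rmorphM /= !mulr0.
Qed.

(** * Dependence of zeros on a parameter *)

(** A further factor $X - z$ with $d \le |z|$ multiplies the constant coefficient by $|z|$ in
    modulus and the bound on the others by at most $2|z|$. *)
Lemma coef_prod_XsubC_bound (s : seq F) (d : F) : 0 <= d ->
  (forall z, z \in s -> d <= `|z|) ->
  forall k, `|(\prod_(z <- s) ('X - z%:P))`_k| * d ^+ k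
    <= 2 ^+ size s * `|(\prod_(z <- s) ('X - z%:P))`_0|.
Proof.
move=> d0; elim: s => [_ k|z s IH sd k].
  rewrite big_nil coef1 coef1 eqxx mul1r; case: k => [|k] /=.
    by rewrite expr0 mulr1.
  by rewrite normr0 mul0r normr1.
have {}IH := IH (fun y ys => sd y (mem_behead (s := z :: s) ys)).
have dz : d <= `|z| by apply: sd; rewrite mem_head.
rewrite big_cons; set p := \prod_(j <- s) _ in IH *.
set B := 2 ^+ size s * `|p`_0| in IH.
have B0 : 0 <= B by rewrite mulr_ge0 ?exprn_ge0.
have coefE i :
    (('X - z%:P) * p)`_i = (if i == 0 then 0 else p`_i.-1) - z * p`_i.
  by rewrite mulrBl coefB coefXM coefCM.
rewrite (coefE 0) eqxx sub0r normrN normrM.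
have -> : 2 ^+ size (z :: s) * (`|z| * `|p`_0|) = `|z| * B + `|z| * B.
  by rewrite /B /= exprS; ring.
rewrite coefE (le_trans (ler_wpM2r (exprn_ge0 _ d0) (ler_normB _ _))) //.
rewrite mulrDl lerD //; last by rewrite normrM -mulrA ler_wpM2l.
case: k => [|k]; first by rewrite eqxx normr0 mul0r mulr_ge0.
rewrite /= exprS mulrCA; apply: le_trans (ler_wpM2l d0 (IH k)) _.
exact: ler_wpM2r.
Qed.

(** Here [n] only bounds the degree, so the constant stays uniform along a family whose degree may
    drop. *)
Lemma coef_bound p (d : F) (n : nat) : 0 <= d -> (size p <= n.+1)%N ->
  (forall z, root p z -> d <= `|z|) ->
  forall k, `|p`_k| * d ^+ k <= 2 ^+ n * `|p`_0|.
Proof.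
move=> d0 sp pd k; have [s ps] := closed_field_poly_normal p.
have [p0|p0] := eqVneq p 0.
  by rewrite p0 !coef0 normr0 mul0r mulr0.
have ss : (size s <= n)%N.
  have l0 : lead_coef p != 0 by rewrite lead_coef_eq0.
  by rewrite -ltnS -(size_prod_XsubC s id) -(size_scale _ l0) -ps.
rewrite {1 2}ps !coefZ !normrM mulrCA -mulrA ler_wpM2l //.
apply: le_trans (coef_prod_XsubC_bound d0 _ k) _.
  by move=> z zs; apply: pd; rewrite ps rootZ ?lead_coef_eq0 // root_prod_XsubC.
by rewrite ler_wpM2r // ler_weXn2l // ler1n.
Qed.

Lemma sqr_normE (z : F) : `|z| ^+ 2 = (Re z ^+ 2 + Im z ^+ 2)%:C.
Proof. by rewrite add_Re2_Im2. Qed.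

Lemma horner2_map_eval P w z :
  P.[w, z] = (map_poly (horner_eval z) P).[w].
Proof. by rewrite -[P in LHS]swapXYK horner2_swapXY horner_polyC swapXYK. Qed.

(* Hurwitz: if all roots of P(., x) had modulus at least d, the previous bound
   on the coefficients would survive in the limit x = 0, where the constant
   coefficient vanishes. *)
Lemma root_near0 P (d : K) : 0 < d -> P.[0, 0] = 0 ->
  (exists w, P.[w, 0] != 0) ->
  exists2 e : K, 0 < e & forall x : K, 0 < x -> x < e ->
    exists2 w : F, `|w| < d%:C & P.[w, x%:C] = 0.
Proof.
move=> d0 P00 [w0 Pw0].
have [k Pk] : exists k, (P`_k).[0] != 0.
  apply: contrapT => Pk; move: Pw0; rewrite horner2_map_eval.
  rewrite (_ : map_poly _ P = 0) ?horner0 ?eqxx //.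
  apply/polyP => k; rewrite coef_map coef0 /=; apply/eqP/contraT => h.
  by case: Pk; exists k.
have [a [b abE]] := horner_Re_Im P`_k; have [c [e ceE]] := horner_Re_Im P`_0.
pose n := size P.
(* [H] is the difference of the squared sides of the coefficient bound, a real polynomial. It is
   positive at 0, so the bound fails for small [x]. *)
pose H : {poly K} := (d ^+ k ^+ 2) *: (a ^+ 2 + b ^+ 2)
    - (2 ^+ n ^+ 2) *: (c ^+ 2 + e ^+ 2).
have HE x : H.[x] = d ^+ k ^+ 2 * (a.[x] ^+ 2 + b.[x] ^+ 2)
    - 2 ^+ n ^+ 2 * (c.[x] ^+ 2 + e.[x] ^+ 2).
  by rewrite /H !hornerE.
have H0 : 0 < H.[0].
  have P0 : (P`_0).[0] = 0.
    move: P00; rewrite horner2_map_eval.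
    by rewrite [X in X = 0 -> _]horner_coef0 coef_map.
  have := ceE 0; rewrite P0 => -[c0 e0].
  rewrite HE -c0 -e0 expr0n /= addr0 mulr0 subr0 mulr_gt0 ?exprn_gt0 //.
  by have := Re2_Im2_gt0 Pk; rewrite (abE 0).
have [eps eps0 epsP] := horner_gt0_near0 H0.
exists eps => // x x0 xe; apply: contrapT => nroot.
have := epsP x x0 xe; apply/negP; rewrite -leNgt HE subr_le0.
pose p := map_poly (horner_eval x%:C) P.
have := @coef_bound p d%:C n; rewrite (lecR 0) (ltW d0) => /(_ isT).
have sp : (size p <= n.+1)%N.
  by rewrite /p map_polyE (leq_trans (size_Poly _)) // size_map leqnSn.
move=> /(_ sp) bound.
have {}bound : forall k, `|p`_k| * d%:C ^+ k <= 2 ^+ n * `|p`_0|.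
  apply: bound => z rz; rewrite real_leNgt ?normr_real ?complex_real //=.
  apply/negP => zd; apply: nroot; exists z => //.
  by rewrite horner2_map_eval; exact: (rootP rz).
have := bound k; rewrite !coef_map /= /horner_eval abE ceE => h.
have h2 : (`|a.[x] +i* b.[x]| * d%:C ^+ k) ^+ 2 <=
    (2 ^+ n * `|c.[x] +i* e.[x]|) ^+ 2.
  have dC : 0 <= d%:C by rewrite (lecR 0) ltW.
  by rewrite lerXn2r // nnegrE mulr_ge0 // exprn_ge0.
move: h2; rewrite !exprMn !sqr_normE /=.
rewrite -(rmorph_nat (real_complex K) 2) -!rmorphXn /= -!rmorphM lecR /= mulrC.
by rewrite [d ^+ k ^+ 2 * _]mulrC.
Qed.

Lemma nonroot_near0 p : p != 0 ->
  exists2 e : K, 0 < e & forall x : K, 0 < x -> x < e -> p.[x%:C] != 0.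
Proof.
move=> /closed_roots[s sP].
suff [e e0 eP] : exists2 e : K, 0 < e &
    forall z : F, z \in s -> 0 < Re z -> e <= Re z.
  exists e => // x x0 xe; apply/negP => /eqP/rootP.
  rewrite sP => /eP /= /(_ x0).
  by rewrite leNgt xe.
elim: s {sP} => [|z s [e e0 eP]]; first by exists 1.
exists (if 0 < Re z then Num.min e (Re z) else e).
  by case: ifP => // zp; rewrite lt_min e0.
move=> y; rewrite inE => /orP[/eqP ->|ys] y0.
  by rewrite y0 ge_min lexx orbT.
by case: ifP => _; rewrite ?ge_min eP.
Qed.

Lemma upper_nbhs (z v : F) : 0 < Im z ->
  exists2 d : K, 0 < d & forall w : F, `|w| < d%:C -> 0 < Im (z + v * w).
Proof.
have normE (u : F) : `|u| = (Re `|u|)%:C by rewrite RRe_real // normr_real.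
have norm0 (u : F) : 0 <= Re `|u|.
  by rewrite -(lecR 0) -normE; exact: (normr_ge0 u).
(* The [+ 1] keeps [m] positive when [v] is zero. *)
move=> z0; pose m := Re `|v| + 1.
have m0 : 0 < m by rewrite ltr_wpDl.
exists (Im z / m); first by rewrite divr_gt0.
move=> w wd.
have vw : `|v * w| < (Im z)%:C.
  rewrite normrM; apply: le_lt_trans (_ : m%:C * `|w| < _).
    by rewrite ler_wpM2r // [leLHS]normE lecR lerDl ler01.
  have -> : (Im z)%:C = m%:C * (Im z / m)%:C.
    by rewrite -rmorphM /= mulrCA divff ?mulr1 // gt_eqF.
  by rewrite ltr_pM2l // (ltcR 0).
rewrite ImD; move: (v * w) vw => u; rewrite normc_def ltcR.
case: u => a b /= h; have : `|b| < Im z.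
  by apply: le_lt_trans h; rewrite -sqrtr_sqr ler_wsqrtr // lerDr sqr_ge0.
by rewrite ltr_norml => /andP[]; lra.
Qed.

(** * Complex lines and translations *)

Lemma horner2_comp P (p : {poly F}) (u : {poly F}) w :
  (map_poly (comp_poly p) P).[u].[w] = P.[u.[w], p.[w]].
Proof.
elim/poly_ind: P => [|P c IH]; first by rewrite rmorph0 !horner0.
rewrite rmorphD rmorphM /= map_polyX map_polyC !hornerMXaddC !hornerE IH.
by rewrite /= horner_comp.
Qed.

(** Unlike in [restrict], base point and direction are complex, so any two points lie on such a
    line. *)
Definition lineXY (z v : F * F) P : {poly F} :=
  (map_poly (comp_poly ((z.2)%:P + v.2 *: 'X)) P).[(z.1)%:P + v.1 *: 'X].

Lemma lineXYE z v P w : (lineXY z v P).[w] = P.[z.1 + v.1 * w, z.2 + v.2 * w].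
Proof. by rewrite /lineXY horner2_comp !hornerE. Qed.

Definition translateXY (z : F * F) P : {poly {poly F}} :=
  map_poly (comp_poly ('X + (z.2)%:P)) P \Po ('X + (z.1)%:P%:P).

Lemma translateXYE z P u w : (translateXY z P).[u, w] = P.[u + z.1, w + z.2].
Proof.
rewrite /translateXY horner_comp hornerD hornerX hornerC.
by rewrite horner2_comp !hornerE.
Qed.

Lemma poly2_nonzero P : P != 0 -> exists u v, P.[u, v] != 0.
Proof.
rewrite -swapXY_eq0 => P0.
have /closed_nonrootP[u] : lead_coef (swapXY P) != 0 by rewrite lead_coef_eq0.
rewrite /root => cu.
have /closed_nonrootP[v] : map_poly (horner_eval u) (swapXY P) != 0.
  apply: contraNneq cu => E.
  have := congr1 (fun p : {poly F} => p`_(size (swapXY P)).-1) E.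
  by rewrite coef_map coef0 => /eqP.
by rewrite /root -horner_polyC => h; exists u, v.
Qed.

(** * Inner Pick functions *)

Section CoprimeQuotient.
Variables R Q : {poly {poly F}}.
Hypotheses (R0 : R != 0) (Q0 : Q != 0) (coprimeRQ : coprimeXY R Q).

(** For any representation $P/S$ of the fraction, coprimality makes [Q] divide [S], so [Q] is
    nonzero wherever [S] is. *)
Lemma has_value_eq z1 z2 v : has_value (tofrac R / tofrac Q) z1 z2 v ->
  Q.[z1, z2] != 0 /\ v = R.[z1, z2] / Q.[z1, z2].
Proof.
case=> P [S [E S0 vE]].
have Sn0 : S != 0 by apply: contraNneq S0 => ->; rewrite !horner0.
have RS : R * S = P * Q.
  apply/eqP; rewrite -tofrac_eq !tofracM -eqr_div ?tofrac_eq0 //.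
  exact/eqP.
have [W SE] := coprimeXY_dvd R0 Q0 coprimeRQ RS.
have Qz : Q.[z1, z2] != 0.
  by apply: contraNneq S0 => Qz; rewrite SE !hornerM Qz mulr0.
split=> //; rewrite vE; apply/eqP; rewrite eqr_div //.
by rewrite -!hornerM RS.
Qed.

Lemma has_value_quotient z1 z2 : Q.[z1, z2] != 0 ->
  has_value (tofrac R / tofrac Q) z1 z2 (R.[z1, z2] / Q.[z1, z2]).
Proof. by move=> Qz; exists R, Q. Qed.

Lemma Im_mulJ_div (z w : F) : w != 0 ->
  Im (z * conjc w) = (Re w ^+ 2 + Im w ^+ 2) * Im (z / w).
Proof.
move=> w0; have := Im_mul_norm (z / w) 1 w.
by rewrite divfK // mul1r conjc1 mulr1.
Qed.

Lemma interlacing_of_rational_inner_Pick :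
  rational_inner_Pick (tofrac R / tofrac Q) ->
  forall x y : K * K, 0 < y.1 -> 0 < y.2 -> real_interlacing_on_line R Q x y.
Proof.
move=> [pick inner] x y y1 y2.
pose conjXY : {poly {poly F}} -> {poly {poly F}} :=
  map_poly (map_poly (@conjc K)).
have conjE P (u v : K) : (conjXY P).[u%:C, v%:C] = conjc P.[u%:C, v%:C].
  rewrite -{1}(conjc_real u) -[(conjc _)%:P](map_polyC conjc) horner_map.
  by rewrite horner_conj_real.
(* Reality almost everywhere becomes a polynomial identity, which then holds on every real line. *)
have symm : R * conjXY Q - conjXY R * Q = 0.
  apply: ae_zero_poly2; apply: negligibleS inner.
  apply: subsetC => -[u v] /= [z zv z0].
  have [Quv zE] := has_value_eq zv.
  rewrite !hornerD !hornerN !hornerM !conjE.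
  have := Im_mulJ_div R.[u%:C, v%:C] Quv; rewrite -zE z0 mulr0.
  case: R.[_, _] Q.[_, _] => [x1 x2] [x3 x4] /=; simpc => h.
  by apply/eqP; rewrite eq_complex /=; apply/andP; split; apply/eqP; lra.
apply: interlacing_of_Pick => [w w0|t].
  rewrite !restrictE.
  have up (a b : K) : 0 < b -> 0 < Im (a%:C + b%:C * w).
    by move=> b0; rewrite ImD Im_realM add0r mulr_gt0.
  have [v /has_value_eq[Qz ->] v0] := pick _ _ (up x.1 _ y1) (up x.2 _ y2).
  by rewrite Im_mulJ_div // mulr_gt0 // Re2_Im2_gt0.
rewrite !restrictE -!rmorphM -!rmorphD /=.
set u := x.1 + _; set v := x.2 + _.
have := congr1 (fun P : {poly {poly F}} => P.[u%:C, v%:C]) symm.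
rewrite !horner0 !hornerD !hornerN !hornerM !conjE.
by case: R.[_, _] Q.[_, _] => [x1 x2] [x3 x4] /=; simpc => -[]; lra.
Qed.

(** * From interlacing to the Pick property *)

Section Converse.
Hypothesis nonconstant : ~ (is_constant R /\ is_constant Q).
Hypothesis interlacing : forall x y : K * K, 0 < y.1 -> 0 < y.2 ->
  real_interlacing_on_line R Q x y.
(** The line with base point the real parts and direction the imaginary parts passes through
    $(u_1,u_2)$ at $w = i$. *)
Lemma upper_Im_ge0_of_nonzero (u1 u2 : F) : 0 < Im u1 -> 0 < Im u2 ->
  R.[u1, u2] != 0 \/ Q.[u1, u2] != 0 ->
  Q.[u1, u2] != 0 /\ 0 <= Im (R.[u1, u2] * conjc Q.[u1, u2]).
Proof.
move=> u1p u2p.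
have := @interlacing_pair_Im_ge0 _ _ 'i%C
  (@interlacing (Re u1, Re u2) (Im u1, Im u2) u1p u2p) ltr01.
by rewrite !restrictE /= ![_ * 'i]mulrC -!complexE.
Qed.

Lemma no_common_zero (z1 z2 : F) : 0 < Im z1 -> 0 < Im z2 -> Q.[z1, z2] != 0.
Proof.
move=> z1_up z2_up; have [Rz|Rz] := eqVneq R.[z1, z2] 0; last first.
  by have [] := upper_Im_ge0_of_nonzero z1_up z2_up (or_introl Rz).
apply/negP => /eqP Qz.
pose r := map_poly (horner_eval z2) R; pose q := map_poly (horner_eval z2) Q.
have [q0|q0] := eqVneq q 0.
  (* [Q] vanishes on the whole line with second coordinate [z2]. If [R] did too, $w_2 - z_2$ would
     be a common factor; so [R] is nonzero at a nearby point of that line. *)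
  have r0 : r != 0.
    apply/negP => /eqP /XsubC_dvd_map_horner[R' RE].
    have [Q' QE] := XsubC_dvd_map_horner q0.
    have : ('X - z2%:P)%:P \is a GRing.unit.
      by apply: (@coprimeRQ _ R' Q'); rewrite mulrC.
    by rewrite poly_unitE coefC /= poly_unitE size_XsubC /= andbF.
  have rt0 : r \Po ('X + z1%:P) != 0 by rewrite comp_poly_eq0 // size_XaddC.
  have [e e0 eP] := nonroot_near0 rt0.
  have e20 : 0 < e / 2 by rewrite divr_gt0.
  have := eP (e / 2) e20.
  rewrite ltr_pdivrMr // mulr_natr mulr2n ltrDl e0 => /(_ isT).
  rewrite horner_comp !hornerE -horner2_map_eval => Ru.
  have [] := @upper_Im_ge0_of_nonzero ((e / 2)%:C + z1) z2 _ z2_up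
    (or_introl Ru).
    by rewrite ImD add0r.
  by rewrite horner2_map_eval -/q q0 horner0 eqxx.
(* The second coordinates of the common zeros are roots of [c]. *)
have [U [V [c [c0 Be]]]] := coprimeXY_Bezout R0 coprimeRQ.
have [d d0 dP] := upper_nbhs 1 z1_up.
pose P := translateXY (z1, z2) Q.
have P00 : P.[0, 0] = 0 by rewrite translateXYE !add0r.
have P0 : exists w, P.[w, 0] != 0.
  have /closed_nonrootP[w qw] := q0; exists (w - z1).
  by rewrite translateXYE subrK add0r horner2_map_eval.
have [e e0 eP] := root_near0 d0 P00 P0.
have ct0 : c \Po ('X + z2%:P) != 0 by rewrite comp_poly_eq0 // size_XaddC.
have [e' e'0 e'P] := nonroot_near0 ct0.
(* Below [e], [Q] has a zero near [z1] at height $z_2 + t$; below [e'], [c] is nonzero there, so [R]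
   cannot vanish with [Q]. *)
pose t := Num.min e e' / 2.
have t0 : 0 < t by rewrite divr_gt0 // lt_min e0.
have tm : t < Num.min e e'.
  by rewrite ltr_pdivrMr // mulr_natr mulr2n ltrDl lt_min e0.
have /= [te te'] : t < e /\ t < e' by move: tm; rewrite lt_min => /andP.
have [w wd] := eP t t0 te; rewrite translateXYE /= => Qu.
have := e'P t t0 te'; rewrite horner_comp !hornerE => cu.
have Ru : R.[w + z1, t%:C + z2] != 0.
  apply: contraNneq cu => Ru.
  have := congr1 (fun p : {poly {poly F}} => p.[w + z1, t%:C + z2]) Be.
  by rewrite !hornerD !hornerM Ru Qu !mulr0 addr0 !hornerC => <-.
have [] := @upper_Im_ge0_of_nonzero (w + z1) (t%:C + z2) _ _ (or_introl Ru).
- by rewrite addrC -[w]mul1r dP.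
- by rewrite ImD add0r.
by rewrite Qu eqxx.
Qed.

(** If $R = cQ$, then [Q] is a common factor, hence constant, and [R] is constant with it. *)
Lemma not_proportional (c : F) : R - c%:P%:P * Q != 0.
Proof.
rewrite subr_eq0; apply/negP => /eqP RE; apply: nonconstant.
have := coprimeRQ RE (esym (mul1r Q)).
rewrite poly_unitE => /andP[sQ uQ].
have [q q0 QE] := size_poly1P _ sQ.
move: uQ; rewrite QE coefC /= poly_unitE => /andP[/size_poly1P[k k0 qE] _].
split; last first.
  by exists k; rewrite qE.
by exists (c * k); rewrite RE QE qE !polyCM.
Qed.

Lemma upper_Im_gt0 (z1 z2 : F) : 0 < Im z1 -> 0 < Im z2 ->
  0 < Im (R.[z1, z2] * conjc Q.[z1, z2]).
Proof.
move=> z1_up z2_up; have Qz := no_common_zero z1_up z2_up.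
have [_] := upper_Im_ge0_of_nonzero z1_up z2_up (or_intror Qz).
rewrite le_eqVlt => /orP[/eqP Im0|//].
have [c RE] : exists c : K, R.[z1, z2] = c%:C * Q.[z1, z2].
  exists (Re (R.[z1, z2] / Q.[z1, z2])).
  have : Im (R.[z1, z2] / Q.[z1, z2]) = 0.
    move: (Im_mulJ_div R.[z1, z2] Qz); rewrite -Im0 => /esym/eqP.
    by rewrite mulf_eq0 (gt_eqF (Re2_Im2_gt0 Qz)) => /eqP.
  move=> I0; rewrite -[LHS](divfK Qz); congr (_ * _).
  by move: I0; case: (_ / _) => a b /= ->.
(* The line from $z$ to a point where $R - cQ$ is nonzero meets the zeros of $R - cQ$ without being
   contained in them, as the Hurwitz argument requires. *)
have [u1 [u2 Tu]] := poly2_nonzero (not_proportional c%:C).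
set T := R - _ in Tu.
pose v := (u1 - z1, u2 - z2).
(* The inner variable is the parameter $t$: a zero of [P] is a point of the line where $R = (c -
   it)Q$. *)
pose P := (lineXY (z1, z2) v T)^:P + ('i%C *: 'X) *: (lineXY (z1, z2) v Q)^:P.
have TE w t : T.[w, t] = R.[w, t] - c%:C * Q.[w, t].
  rewrite /T hornerD hornerN hornerM !hornerC.
  by rewrite hornerD hornerN hornerM hornerC.
have PE w t : P.[w, t] = T.[z1 + v.1 * w, z2 + v.2 * w]
    + 'i%C * t * Q.[z1 + v.1 * w, z2 + v.2 * w].
  rewrite /P hornerD hornerZ !horner_map /= hornerD hornerM !hornerC !hornerE.
  by rewrite !lineXYE TE.
have P00 : P.[0, 0] = 0.
  by rewrite PE !mulr0 mul0r !addr0 TE RE subrr.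
have P10 : exists w, P.[w, 0] != 0.
  exists 1; rewrite PE !mulr0 mul0r addr0 !mulr1 /=.
  by rewrite ![z1 + _]addrC ![z2 + _]addrC !subrK.
have [d1 d10 d1P] := upper_nbhs v.1 z1_up.
have [d2 d20 d2P] := upper_nbhs v.2 z2_up.
have d0 : 0 < Num.min d1 d2 by rewrite lt_min d10.
have [e e0 eP] := root_near0 d0 P00 P10.
have e20 : 0 < e / 2 by rewrite divr_gt0.
have [|w wd E] := eP (e / 2) e20.
  by rewrite ltr_pdivrMr // mulr_natr mulr2n ltrDl.
have w1 : 0 < Im (z1 + v.1 * w).
  by apply: d1P; apply: lt_le_trans wd _; rewrite lecR ge_min lexx.
have w2 : 0 < Im (z2 + v.2 * w).
  by apply: d2P; apply: lt_le_trans wd _; rewrite lecR ge_min lexx orbT.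
have Qw := no_common_zero w1 w2.
have [_] := upper_Im_ge0_of_nonzero w1 w2 (or_intror Qw).
rewrite PE TE in E; rewrite leNgt => /negP h; case: h.
have -> : R.[z1 + v.1 * w, z2 + v.2 * w] =
    (c%:C - 'i%C * (e / 2)%:C) * Q.[z1 + v.1 * w, z2 + v.2 * w].
  by apply/eqP; rewrite -subr_eq0 -E; apply/eqP; ring.
have := Re2_Im2_gt0 Qw; move: Q.[_, _] => q qn.
rewrite -[q in conjc q]mul1r Im_mul_norm pmulr_rlt0 //.
by simpc => /=; lra.
Qed.

Lemma rational_inner_Pick_of_interlacing :
  rational_inner_Pick (tofrac R / tofrac Q).
Proof.
split=> [z1 z2 z1_up z2_up|].
  have Qz := no_common_zero z1_up z2_up.
  exists (R.[z1, z2] / Q.[z1, z2]); first exact: has_value_quotient.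
  have := upper_Im_gt0 z1_up z2_up; rewrite Im_mulJ_div //.
  by rewrite pmulr_rgt0 // Re2_Im2_gt0.
exists [set x : K * K | Q.[x.1%:C, x.2%:C] = 0]%classic; split.
- exact: measurable_zeros2.
- exact: null_zeros2.
move=> x /=; apply: contra_notP => /eqP Qx.
exists (R.[x.1%:C, x.2%:C] / Q.[x.1%:C, x.2%:C]).
  exact: has_value_quotient.
(* The point [x] is the parameter value 0 on the line through it in the direction $(1,1)$. *)
have := @interlacing_pair_real _ _ 0 (@interlacing x (1, 1) ltr01 ltr01).
rewrite !restrictE /= !mulr0 !addr0 Im_mulJ_div // => /eqP.
by rewrite mulf_eq0 (gt_eqF (Re2_Im2_gt0 Qx)) => /eqP.
Qed.
End Converse.
End CoprimeQuotient.
End InnerPick.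

Theorem theorem6p6 (K : realType) (R Q : {poly {poly K[i]}})
  (R_neq0 : R != 0) (Q_neq0 : Q != 0)
  (nonconstant : ~ (is_constant R /\ is_constant Q))
  (coprimeRQ : no_common_factor R Q) :
  rational_inner_Pick (tofrac R / tofrac Q) <->
  (forall x y : K * K, 0 < y.1 -> 0 < y.2 ->
     real_interlacing_on_line R Q x y).
Proof.
split; first exact: interlacing_of_rational_inner_Pick.
exact: rational_inner_Pick_of_interlacing.
Qed.
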